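(* Let $\Omega=\{1,\dots,d\}^{\mathbb N}$ with the shift $\sigma$, and assume $A:\Omega\to\mathbb R$ depends only on the first two coordinates, $A(x)=A(x_0,x_1)$. Let $x,y,z\in\Omega$ and $n\ge1$. Assume that $d(z,x)\le\frac14$, that $\sigma^n(z)=y$, and that there exists $1\le k<n$ such that $d(\sigma^k(z),x)\le\frac14$. Then $$S_n(A-m(A))(z)\le S_{n-k}(A-m(A))(\sigma^k(z)).$$
   Context: $\Omega$ carries the metric $d(x,y)=2^{-\min\{n:\ x_n\ne y_n\}}$ and $\sigma(x_0x_1x_2\ldots)=x_1x_2\ldots$. $m(A)=\max\int A\,d\nu$ over $\sigma$-invariant Borel probability measures $\nu$ on $\Omega$. $S_n(f)=f+f\circ\sigma+\dots+f\circ\sigma^{n-1}$. *)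

(* Defs.v *)
From HB Require Import structures.
From mathcomp Require Import all_boot all_order all_algebra.
From mathcomp Require Import all_classical all_reals all_analysis.
Set Implicit Arguments.
Unset Strict Implicit.
Unset Printing Implicit Defensive.
Import Order.TTheory GRing.Theory Num.Theory.
Import numFieldNormedType.Exports.
Local Open Scope classical_set_scope.
Local Open Scope ring_scope.

(* The full shift on d.+1 symbols: a nonempty alphabet is needed because
   measurable types are pointed, and the symbols are numbered from 0 to d
   instead of from 1.  [R] is a phantom parameter: it is the type in which the
   metric of the canonical [metricType R] instance below takes its values. *)
Definition Omega (R : realType) (d : nat) : Type := nat -> 'I_d.+1.

HB.instance Definition _ (R : realType) (d : nat) :=
  Choice.copy (Omega R d) (nat -> 'I_d.+1).
HB.instance Definition _ (R : realType) (d : nat) :=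
  isPointed.Build (Omega R d) (fun=> ord0).

Section OmegaMetric.
Context {R : realType} {d : nat}.
Implicit Types x y z : Omega R d.

Definition omega_dist x y : R :=
  match pselect (exists n, x n != y n) with
  | left xy => 2 ^- (ex_minn xy)
  | right _ => 0
  end.

Lemma omega_distP x y n :
  reflect (forall i, (i < n)%N -> x i = y i) (omega_dist x y <= 2 ^- n).
Proof.
rewrite /omega_dist; case: pselect => [xy|xy]; last first.
  rewrite invr_ge0 exprn_ge0//; apply: ReflectT => i _.
  by apply/eqP; apply: contra_notT xy => xi; exists i.
case: ex_minnP => m xm mmin.
rewrite lef_pV2 ?posrE ?exprn_gt0// ler_eXn2l ?ltr1n//.
apply: (iffP idP) => [nm i ilt|H].
  apply/eqP; apply: contraT => /mmin mi.
  by have := leq_trans ilt (leq_trans nm mi); rewrite ltnn.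
by rewrite leqNgt; apply: contra xm => /H ->.
Qed.

Lemma omega_distxx x : omega_dist x x = 0.
Proof.
rewrite /omega_dist; case: pselect => // xx.
by exfalso; case: xx => n; rewrite eqxx.
Qed.

Lemma omega_dist_eq0 x y : omega_dist x y = 0 -> x = y.
Proof.
move=> xy0; apply/funext => i.
have /omega_distP : omega_dist x y <= 2 ^- i.+1.
  by rewrite xy0 invr_ge0 exprn_ge0.
by apply.
Qed.

Lemma omega_dist_sym x y : omega_dist x y = omega_dist y x.
Proof.
rewrite /omega_dist; case: pselect => [xy|xy]; case: pselect => [yx|yx] //.
- congr (2 ^- _); case: ex_minnP => m xm mmin; case: ex_minnP => p yp pmin.
  by apply/eqP; rewrite eqn_leq mmin 1?eq_sym// pmin 1?eq_sym.
- by case: yx; case: xy => n xn; exists n; rewrite eq_sym.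
- by case: xy; case: yx => n xn; exists n; rewrite eq_sym.
Qed.

Lemma omega_dist_ge0 x y : 0 <= omega_dist x y.
Proof.
by rewrite /omega_dist; case: pselect => // xy; rewrite invr_ge0 exprn_ge0.
Qed.

Lemma omega_dist_triangle y x z :
  omega_dist x z <= omega_dist x y + omega_dist y z.
Proof.
rewrite {1}/omega_dist; case: pselect => [xz|_]; last first.
  by rewrite addr_ge0// omega_dist_ge0.
case: ex_minnP => m xm _.
have [xy|] := eqVneq (x m) (y m).
  rewrite -[leLHS]add0r lerD ?omega_dist_ge0// leNgt; apply/negP => yz.
  have yzm : exists n, y n != z n by exists m; rewrite -xy.
  move: yz; rewrite /omega_dist; case: pselect => // {}yzm.
  case: ex_minnP => p _ /(_ m); rewrite -xy => /(_ xm) pm.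
  by rewrite ltf_pV2 ?posrE ?exprn_gt0// ltr_eXn2l ?ltr1n// ltnNge pm.
move=> xy; rewrite -[leLHS]addr0 lerD ?omega_dist_ge0// leNgt; apply/negP.
rewrite /omega_dist; case: pselect => [yzm|[]]; last by exists m.
case: ex_minnP => p _ /(_ m) /(_ xy) pm.
by rewrite ltf_pV2 ?posrE ?exprn_gt0// ltr_eXn2l ?ltr1n// ltnNge pm.
Qed.

HB.instance Definition _ := isMetric.Build R (Omega R d)
  omega_distxx omega_dist_eq0 omega_dist_sym omega_dist_triangle.

Lemma mdist_OmegaE x y : mdist x y = omega_dist x y.
Proof. by []. Qed.

End OmegaMetric.

Definition left_shift {R : realType} {d : nat} (x : Omega R d) : Omega R d :=
  fun n => x n.+1.

Definition OmegaBorel (R : realType) (d : nat) : measurableType _ :=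
  g_sigma_algebraType (@open (Omega R d)).

Definition shift_invariant {R : realType} {d : nat}
    (nu : probability (OmegaBorel R d) R) : Prop :=
  forall B : set (OmegaBorel R d), measurable B -> nu (left_shift @^-1` B) = nu B.

Definition invariant_integrals {R : realType} {d : nat} (A : Omega R d -> R) :
    set R :=
  [set r | exists2 nu : probability (OmegaBorel R d) R,
    shift_invariant nu & r = \int[nu]_w A w].

(* The supremum agrees with the maximum, by [max_integralE]. *)
Definition max_integral {R : realType} {d : nat} (A : Omega R d -> R) : R :=
  sup (invariant_integrals A).

Lemma max_integralE (R : realType) (d : nat) (A : Omega R d -> R) (c : R) :
  invariant_integrals A c -> ubound (invariant_integrals A) c ->
  max_integral A = c.
Proof.
move=> Ac cub; apply/eqP; rewrite eq_le; apply/andP; split.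
  by apply: ge_sup => //; exists c.
by apply: ub_le_sup => //; exists c.
Qed.

Definition birkhoff_sum {R : realType} {d : nat} (n : nat) (f : Omega R d -> R)
    (x : Omega R d) : R :=
  \sum_(i < n) f (iter i left_shift x).

(* Main.v *)
Require Import Defs.
From HB Require Import structures.
From mathcomp Require Import all_boot all_order all_algebra.
From mathcomp Require Import all_classical all_reals all_analysis.
From mathcomp Require Import measurable_realfun.
Import Order.TTheory GRing.Theory Num.Theory.
Import numFieldNormedType.Exports.
Local Open Scope ring_scope.

(** Since [z] and [sigma^k z] both agree with [x] on the first two symbols, the
    block [z_0 ... z_{k-1}] is followed by the symbol [z_0]; repeating it gives a
    [k]-periodic point [p] with [S_k A (p) = S_k A (z)].  The uniform measure on
    the orbit of [p] is invariant, so [S_k A (p) <= k m(A)], and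
    [S_n - S_{n-k} \o sigma^k = S_k]. *)

Section probability_integral.
Context {disp : measure_display} {T : measurableType disp} {R : realType}.
Variable P : probability T R.

Lemma bounded_integrable_probability {f : T -> R} {C : R} :
  measurable_fun setT f -> (forall w, `|f w| <= C) ->
  P.-integrable setT (EFin \o f).
Proof.
move=> mf fC; apply: measurable_bounded_integrable => //.
  exact: le_lt_trans (probability_le1 P measurableT) (ltry 1).
by exists C; split; [exact: num_real|move=> M /ltW CM w _; exact: le_trans CM].
Qed.

Lemma Rintegral_cst_probability (c : R) : \int[P]_w c = c.
Proof.
by rewrite Rintegral_cst// [X in fine X](probability_setT P) mulr1.
Qed.

End probability_integral.

Section empirical_measure.
Context {disp : measure_display} {T : measurableType disp} {R : realType}.
Variables (u : nat -> T) (n : nat).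

(* The length is [n.+1] so that the weight [1 / n.+1] is never [1 / 0]. *)
Definition empirical_measure : set T -> \bar R :=
  mscale (NngNum (ltW (divr_gt0 ltr01 (ltr0Sn R n))))
    (msum (fun i => dirac (u i)) n.+1).

HB.instance Definition _ := Measure.on empirical_measure.

Lemma empirical_measureE (B : set T) :
  empirical_measure B = ((1 / n.+1%:R)%:E * \sum_(i < n.+1) \d_(u i) B)%E.
Proof. by []. Qed.

Let empirical_measure_setT : empirical_measure setT = 1%E.
Proof.
rewrite empirical_measureE; under eq_bigr do rewrite diracT.
by rewrite sumEFin sumr_const card_ord -EFinM divfK ?pnatr_eq0.
Qed.

HB.instance Definition _ := Measure_isProbability.Build _ _ _
  empirical_measure empirical_measure_setT.

Lemma ge0_Rintegral_empirical (f : T -> R) : measurable_fun setT f ->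
  (forall w, 0 <= f w) ->
  \int[empirical_measure]_w f w = (1 / n.+1%:R) * \sum_(i < n.+1) f (u i).
Proof.
move=> mf f0; have /measurable_EFinP mEf := mf.
rewrite /Rintegral ge0_integral_mscale//; last by move=> w _; rewrite lee_fin.
rewrite ge0_integral_measure_sum//; last by move=> w _; rewrite lee_fin.
under eq_bigr do rewrite integral_dirac// diracT mul1e.
by rewrite /= sumEFin -EFinM.
Qed.

Lemma Rintegral_empirical {f : T -> R} {C : R} : measurable_fun setT f ->
  (forall w, `|f w| <= C) ->
  \int[empirical_measure]_w f w = (1 / n.+1%:R) * \sum_(i < n.+1) f (u i).
Proof.
move=> mf fC.
have /= : \int[empirical_measure]_w (f w + C) =
    (1 / n.+1%:R) * \sum_(i < n.+1) (f (u i) + C).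
  rewrite ge0_Rintegral_empirical//; first exact: measurable_funD.
  by move=> w; rewrite -lerBlDr sub0r; have /ler_normlP[] := fC w; rewrite lerNl.
rewrite RintegralD//; [|exact: bounded_integrable_probability fC|]; last first.
  exact: (bounded_integrable_probability _ (measurable_cst C) (fun=> lexx `|C|)).
rewrite (Rintegral_cst_probability empirical_measure) big_split/= sumr_const card_ord.
rewrite mulrDr -[C *+ _]mulr_natl (mulrA _ _ C) divfK ?pnatr_eq0//.
by rewrite [1 * C]mul1r => /addIr.
Qed.

End empirical_measure.

Section shift.
Context {R : realType} {d : nat}.
Implicit Types (x y p z : Omega R d) (A : Omega R d -> R).

Lemma iter_left_shiftE k x i : iter k left_shift x i = x (k + i)%N.
Proof. by elim: k i => //= k IH i; rewrite /left_shift IH addnS. Qed.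

Lemma mdist_le_quarter_agree {x y} : mdist x y <= 1 / 4 -> x 0%N = y 0%N.
Proof.
have -> : 1 / 4 = 2 ^- 2 :> R by rewrite -natrX div1r.
by rewrite mdist_OmegaE => /omega_distP; apply.
Qed.

Lemma birkhoff_sumD k n (f : Omega R d -> R) z :
  birkhoff_sum (k + n) f z =
  birkhoff_sum k f z + birkhoff_sum n f (iter k left_shift z).
Proof.
rewrite /birkhoff_sum big_split_ord/=; congr (_ + _).
by apply: eq_bigr => i _; rewrite addnC iterD.
Qed.

Lemma birkhoff_sumBcst n A (c : R) z :
  birkhoff_sum n (fun w => A w - c) z = birkhoff_sum n A z - n%:R * c.
Proof.
by rewrite /birkhoff_sum sumrB sumr_const card_ord mulr_natl.
Qed.

Lemma locally_constant_measurable {A} n :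
  (forall x y, (forall i, (i < n)%N -> x i = y i) -> A x = A y) ->
  measurable_fun (setT : set (OmegaBorel R d)) A.
Proof.
move=> An _ B mB; rewrite setTI; apply: sub_sigma_algebra.
suff : @open (Omega R d) (A @^-1` B)%classic by [].
rewrite openE => w Bw; apply/nbhs_ballP; exists (2 ^- n) => /=.
  by rewrite invr_gt0 exprn_gt0.
move=> v; rewrite ballEmdist/= mdist_OmegaE => /ltW/omega_distP wv.
by rewrite /preimage/= -(An _ _ wv).
Qed.

Lemma orbit_measure_invariant p k : iter k.+1 left_shift p = p ->
  shift_invariant
    (empirical_measure (fun i => iter i left_shift p : OmegaBorel R d) k
      : probability (OmegaBorel R d) R).
Proof.
move=> pk B mB; rewrite /= [LHS]empirical_measureE [RHS]empirical_measureE.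
congr (_ * _)%E; under eq_bigr do rewrite diracE.
rewrite big_ord_recr [RHS]big_ord_recl/= addeC; congr (_ + _)%E.
by rewrite diracE -[in RHS]pk.
Qed.

Lemma periodic_birkhoff_sum_le {A p k} {C : R} :
  measurable_fun (setT : set (OmegaBorel R d)) A -> (forall w, `|A w| <= C) ->
  iter k left_shift p = p -> birkhoff_sum k A p <= k%:R * max_integral A.
Proof.
case: k => [|k] mA AC pk; first by rewrite /birkhoff_sum big_ord0 mul0r.
rewrite mulrC -ler_pdivrMr ?ltr0Sn// mulrC -[_^-1]div1r.
apply: ub_le_sup; last first.
  eexists; first exact: orbit_measure_invariant pk.
  by rewrite (Rintegral_empirical _ _ mA AC).
exists C => _ [nu _ ->].
have : \int[nu]_w A w <= \int[nu]_w C.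
  apply: le_Rintegral => //.
  - exact: (bounded_integrable_probability nu mA AC).
  - exact: (bounded_integrable_probability _ (measurable_cst C) (fun=> lexx `|C|)).
  - by move=> w _; exact: le_trans (ler_norm _) (AC w).
by rewrite Rintegral_cst_probability.
Qed.

End shift.

Theorem lemma4p5 (R : realType) (d : nat) (A : Omega R d -> R)
    (hA : exists a : 'I_d.+1 -> 'I_d.+1 -> R,
      forall w : Omega R d, A w = a (w 0%N) (w 1%N))
    (x y z : Omega R d) (n : nat) (hn : (1 <= n)%N)
    (hzx : mdist z x <= 1 / 4)
    (hzy : iter n left_shift z = y)
    (k : nat) (hk : (1 <= k < n)%N)
    (hkx : mdist (iter k left_shift z) x <= 1 / 4) :
  birkhoff_sum n (fun w => A w - max_integral A) z
    <= birkhoff_sum (n - k) (fun w => A w - max_integral A) (iter k left_shift z).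
Proof.
have [a Aa] := hA; have /andP[k0 kn] := hk.
rewrite -{1}(subnKC (ltnW kn)) birkhoff_sumD gerDr birkhoff_sumBcst subr_le0.
have zk : z k = z 0%N.
  by rewrite (mdist_le_quarter_agree hzx) -(mdist_le_quarter_agree hkx)
     iter_left_shiftE addn0.
pose p : Omega R d := fun i => z (i %% k)%N.
have pk : iter k left_shift p = p.
  by apply/funext => i; rewrite iter_left_shiftE /p modnDl.
have -> : birkhoff_sum k A z = birkhoff_sum k A p.
  apply: eq_bigr => i _; rewrite !Aa !iter_left_shiftE /p !addn0 addn1.
  rewrite (modn_small (ltn_ord i)).
  have [ik|ik] := eqVneq i.+1 k; first by rewrite ik modnn zk.
  by rewrite modn_small// ltn_neqAle ik ltn_ord.
apply: (periodic_birkhoff_sum_le (C := \sum_i \sum_j `|a i j|) _ _ pk).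
  by apply: (@locally_constant_measurable _ _ _ 2) => u v uv; rewrite !Aa !uv.
move=> w; rewrite Aa (bigD1 (w 0%N))//= (bigD1 (w 1%N))//= -addrA lerDl.
by rewrite addr_ge0// ?sumr_ge0// => i _; rewrite sumr_ge0.
Qed.
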